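(* Let $((F,\nu,N),[\,,]_{F,h},(\rho,\eta))$ be a generalized Lie algebroid. The $\mathcal F(N)$-multilinear application $d^F:\Lambda^q(F,\nu,N)\to\Lambda^{q+1}(F,\nu,N)$ defined by $$d^F\omega(z_0,z_1,\dots,z_q)=\sum_{i=0}^q(-1)^i\,\Gamma(Th\circ\rho,h\circ\eta)z_i\big(\omega(z_0,z_1,\dots,\hat z_i,\dots,z_q)\big)+\sum_{i<j}(-1)^{i+j}\omega\big([z_i,z_j]_{F,h},z_0,z_1,\dots,\hat z_i,\dots,\hat z_j,\dots,z_q\big)$$ for any $z_0,z_1,\dots,z_q\in\Gamma(F,\nu,N)$, is unique with the following property: $$L_z=d^F\circ i_z+i_z\circ d^F\qquad\text{for all }z\in\Gamma(F,\nu,N).$$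
   Context: $\mathcal F(N)$ is the ring of smooth real functions on a manifold $N$, and $\Gamma(F,\nu,N)$ is the $\mathcal F(N)$-module of sections of a vector bundle $\nu:F\to N$. For a vector bundle morphism $(\varphi,\varphi_0)$ with $\varphi_0$ a diffeomorphism, $\Gamma(\varphi,\varphi_0)u=\varphi\circ u\circ\varphi_0^{-1}$ on sections. A generalized Lie algebroid $((F,\nu,N),[\,,]_{F,h},(\rho,\eta))$ consists of manifolds $M,N$, diffeomorphisms $h:M\to N$ and $\eta:N\to M$, a vector bundle $(F,\nu,N)$, a vector bundle morphism $(\rho,\eta)$ from $(F,\nu,N)$ to $(TM,\tau_M,M)$, and an operation $[\,,]_{F,h}$ on $\Gamma(F,\nu,N)$ such that: (1) $[u,fv]_{F,h}=f[u,v]_{F,h}+\big(\Gamma(Th\circ\rho,h\circ\eta)(u)f\big)v$ for all sections $u,v$ and $f\in\mathcal F(N)$; (2) $(\Gamma(F,\nu,N),+,\cdot,[\,,]_{F,h})$ is a Lie $\mathcal F(N)$-algebra; (3) $\Gamma(Th\circ\rho,h\circ\eta)$ is a Lie algebra morphism from $(\Gamma(F,\nu,N),+,\cdot,[\,,]_{F,h})$ to $(\Gamma(TN,\tau_N,N),+,\cdot,[\,,]_{TN})$. $\Lambda^q(F,\nu,N)$ is the set of $q$-linear applications $\omega:\Gamma(F,\nu,N)^q\to\mathcal F(N)$ such that $\omega(z_{\sigma(1)},\dots,z_{\sigma(q)})=\mathrm{sgn}(\sigma)\,\omega(z_1,\dots,z_q)$ for all sections $z_1,\dots,z_q$ and all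 permutations $\sigma$ of $\{1,\dots,q\}$; for $q=0$ it is $\mathcal F(N)$. $\Lambda(F,\nu,N)=\bigoplus_{q\ge0}\Lambda^q(F,\nu,N)$. For $z\in\Gamma(F,\nu,N)$, the covariant Lie derivative with respect to $z$ is the application $L_z:\Lambda(F,\nu,N)\to\Lambda(F,\nu,N)$ (also called $\mathcal F(N)$-multilinear) given by $L_z(f)=\Gamma(Th\circ\rho,h\circ\eta)z(f)$ for $f\in\mathcal F(N)$ and $L_z\omega(z_1,\dots,z_q)=\Gamma(Th\circ\rho,h\circ\eta)z\big(\omega(z_1,\dots,z_q)\big)-\sum_{i=1}^q\omega(z_1,\dots,[z,z_i]_{F,h},\dots,z_q)$ for $\omega\in\Lambda^q(F,\nu,N)$. The interior product associated to $z$ is the $\mathcal F(N)$-multilinear application $i_z$ sending $\omega\in\Lambda^q(F,\nu,N)$ to $i_z\omega\in\Lambda^{q-1}(F,\nu,N)$, $i_z\omega(z_2,\dots,z_q)=\omega(z,z_2,\dots,z_q)$, with $i_zf=0$ for $f\in\mathcal F(N)$. A hat means that the argument is omitted.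
   Formalization: ''F(N)-multilinear'' is read as: d^Fω is F(N)-multilinear in z_0,…,z_q and d^F is linear over real constants, since d(fg)=f dg+g df shows d^F is not F(N)-linear in ω; likewise the bracket of the Lie F(N)-algebra is bilinear over real constants only. *)

(* Defs.v *)
From HB Require Import structures.
From mathcomp Require Import all_boot all_order all_algebra all_fingroup.
From mathcomp Require Import all_classical all_reals all_analysis.
From mathcomp Require Import ssrAC.

Set Implicit Arguments.
Unset Strict Implicit.
Unset Printing Implicit Defensive.

Import Order.TTheory GRing.Theory Num.Theory.
Import numFieldNormedType.Exports.
Local Open Scope classical_set_scope.
Local Open Scope ring_scope.

(* C^k on the open set U; values outside U are irrelevant. *)
Fixpoint Ck (R : realType) n (V : normedModType R) (k : nat)
    (U : set 'rV[R]_n) (f : 'rV[R]_n -> V) : Prop :=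
  if k is k'.+1 then
    (forall x, U x -> differentiable f x) /\ (forall v, Ck k' U ('D_v f))
  else forall x, U x -> {for x, continuous f}.

Definition Cinfty (R : realType) n (V : normedModType R)
  (U : set 'rV[R]_n) (f : 'rV[R]_n -> V) : Prop := forall k, Ck k U f.

Section Calculus.
Variable R : realType.

Lemma near_eq_differentiable (V W : normedModType R) (f g : V -> W) x :
  {near x, f =1 g} -> differentiable f x -> differentiable g x.
Proof.
move=> fg df; have fgx : f x = g x := nbhs_singleton fg.
suff H : g \o shift x = cst (g x) + 'd f x +o_ 0 id.
  apply/diff_locallyP.
  have e := diff_unique (@diff_continuous _ _ _ (nbhs x) _ df) H.
  by split; rewrite e //; exact: (@diff_continuous _ _ _ (nbhs x) _ df).
have [_ dfx] := (diff_locallyP x f).1 df.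
apply/eqaddoP => e e0.
have {}dfx := (eqaddoP _ _ _ _).1 dfx e e0.
have fg0 : \forall y \near 0, f (y + x) = g (y + x).
  rewrite (near_shift x); near=> y; rewrite /= sub0r subrK; near: y; exact: fg.
near=> y.
have -> : (g \o shift x - (cst (g x) + 'd f x)) y = (f \o shift x - (cst (f x) + 'd f x)) y.
  rewrite !fctE /= fgx; congr (_ - _); apply/esym; near: y; exact: fg0.
by near: y.
Unshelve. all: by end_near. Qed.

Section fixn.
Variables (n : nat).
Implicit Types (V W : normedModType R) (U : set 'rV[R]_n).

Lemma Ck_sub k V U U' (f : 'rV_n -> V) : U' `<=` U -> Ck k U f -> Ck k U' f.
Proof.
move=> UU; elim: k f => [|k IH] f /=; first by move=> h x /UU; apply: h.
by case=> h1 h2; split=> [x /UU|v]; [exact: h1|apply: IH].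
Qed.

Lemma Ck_loc k V U (f : 'rV_n -> V) :
  (forall x, U x -> exists2 W, W x & Ck k W f) -> Ck k U f.
Proof.
elim: k f => [|k IH] f /= h; first by move=> x /h[W Wx]; apply.
split=> [x /h[W Wx [+ _]]|v]; first exact.
by apply: IH => x /h[W Wx [_ +]]; exists W.
Qed.

Lemma Ck_eq k V U (f g : 'rV_n -> V) : open U -> {in U, f =1 g} ->
  Ck k U f -> Ck k U g.
Proof.
move=> oU; elim: k f g => [|k IH] f g fg /=.
  move=> h x Ux; have fgx : \near x, f x = g x.
    by apply: filterS (open_nbhs_nbhs (conj oU Ux)) => y Uy; apply: fg; exact/mem_set.
  have := h x Ux; rewrite /prop_for /continuous_at -(nbhs_singleton fgx) => c.
  exact: cvg_trans (near_eq_cvg fgx) c.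
have fgx x : U x -> \near x, f x = g x.
  by move=> Ux; apply: filterS (open_nbhs_nbhs (conj oU Ux)) => y Uy; apply: fg; exact/mem_set.
case=> h1 h2; split=> [x Ux|v].
  by apply: near_eq_differentiable (h1 _ Ux); exact: fgx.
apply: IH (h2 v) => x /set_mem Ux; exact/near_eq_derive/fgx.
Qed.

Lemma CkS k V U (f : 'rV_n -> V) : Ck k.+1 U f -> Ck k U f.
Proof.
elim: k f => [|k IH] f; last by case=> h1 h2; split=> // v; apply: IH; exact: h2.
by case=> h1 _ x Ux; apply/differentiable_continuous/h1.
Qed.

Lemma Ck_cst k V U (a : V) : Ck k U (cst a : 'rV_n -> V).
Proof.
elim: k a => [|k IH] a /=; first by move=> x _; apply: cst_continuous.
split=> // v; have -> : 'D_v (cst a) = cst (0 : V) :> ('rV[R]_n -> V); last exact: IH.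
by apply/funext => x; rewrite derive_cst.
Qed.

Lemma Ck_add k V U (f g : 'rV_n -> V) : open U -> Ck k U f -> Ck k U g -> Ck k U (f \+ g).
Proof.
move=> oU; elim: k f g => [|k IH] f g /=.
  by move=> hf hg x Ux; apply: continuousD; [exact: hf|exact: hg].
move=> [f1 f2] [g1 g2]; split=> [x Ux|v].
  by apply: differentiableD; [exact: f1|exact: g1].
apply: Ck_eq (IH _ _ (f2 v) (g2 v)) => // x /set_mem Ux /=.
by rewrite -deriveD //; apply: diff_derivable; [exact: f1|exact: g1].
Qed.

Lemma Ck_sum k V U (I : Type) (s : seq I) (f : I -> 'rV_n -> V) : open U ->
  (forall i, Ck k U (f i)) -> Ck k U (fun x => \sum_(i <- s) f i x).
Proof.
move=> oU h; elim: s => [|i s IH].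
  by under eq_fun do rewrite big_nil; exact: Ck_cst.
by under eq_fun do rewrite big_cons; exact: Ck_add.
Qed.

Lemma scale_is_bilinear V : bilinear_for
  (GRing.Scale.Law.clone _ _ *:%R _) (GRing.Scale.Law.clone _ _ *:%R _)
  (@GRing.scale R V : R -> V -> V).
Proof.
split=> [u'|u] a x y /=; first by rewrite scalerDl scalerA.
by rewrite scalerDr !scalerA mulrC.
Qed.

Lemma diff_scale V (a : 'rV_n -> R) (f : 'rV_n -> V) x :
  differentiable a x -> differentiable f x ->
  differentiable (fun x => a x *: f x) x /\
  forall v, 'D_v (fun x => a x *: f x) x = 'D_v a x *: f x + a x *: 'D_v f x.
Proof.
move=> da df.
pose m := bilinear_isBilinear.Build R R V V _ _ (@GRing.scale R V)
  (scale_is_bilinear V).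
pose B : {bilinear R -> V -> V} := HB.pack (@GRing.scale R V : R -> V -> V) m.
have cB : continuous (fun p => B p.1 p.2) by exact: scale_continuous.
have dp := differentiable_pair da df.
have dB := @differentiable_bilin R R V V B (a x, f x) cB.
have dc : differentiable (fun x => a x *: f x) x.
  exact: (differentiable_comp dp dB).
split=> // v; rewrite deriveE // (diff_comp dp dB) /= (diff_pair da df) /=.
rewrite (@diff_bilin R R V V B _ cB) /= !deriveE //.
by rewrite addrC.
Qed.

Lemma Ck_scale k V U (a : 'rV_n -> R) (f : 'rV_n -> V) : open U ->
  Ck k U a -> Ck k U f -> Ck k U (fun x => a x *: f x).
Proof.
move=> oU; elim: k a f => [|k IH] a f.
  by move=> ha hf x Ux; apply: continuousZ; [exact: ha|exact: hf].
move=> ha hf; have [a1 a2] := ha; have [f1 f2] := hf.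
split=> [x Ux|v]; first by have [] := diff_scale (a1 _ Ux) (f1 _ Ux).
apply: (@Ck_eq _ _ _ ((fun x => 'D_v a x *: f x) \+ (fun x => a x *: 'D_v f x))) => //.
  by move=> x /set_mem Ux /=; have [_ ->] := diff_scale (a1 _ Ux) (f1 _ Ux).
by apply: Ck_add => //; apply: IH => //; try (exact: a2); try (exact: f2); exact: CkS.
Qed.

Lemma Ck_lin k V W U (L : {linear V -> W}) (f : 'rV_n -> V) : open U ->
  continuous L -> Ck k U f -> Ck k U (L \o f).
Proof.
move=> oU cL; elim: k f => [|k IH] f /=.
  by move=> h x Ux; apply: continuous_comp; [exact: h|exact: cL].
case=> h1 h2; split=> [x Ux|v].
  by apply: differentiable_comp; [exact: h1|exact: linear_differentiable].
apply: Ck_eq (IH _ (h2 v)) => // x /set_mem Ux /=.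
have df := h1 _ Ux; have dL := @linear_differentiable R V W L (f x) cL.
rewrite (deriveE _ df) (deriveE _ (differentiable_comp df dL)).
by rewrite (diff_comp df dL) /= (@diff_lin R V W L (f x) cL).
Qed.

Lemma Ck_coord k m U (f : 'rV[R]_n -> 'rV[R]_m) i : open U ->
  Ck k U f -> Ck k U (fun x => f x ord0 i : R).
Proof.
move=> oU hf.
pose c (N : 'rV[R]_m) : R := N ord0 i.
have lc : linear c by move=> a x y; rewrite /c !mxE.
pose M := GRing.isLinear.Build _ _ _ _ _ lc.
pose C : {linear 'rV[R]_m -> R} := HB.pack c M.
by apply: (@Ck_lin _ _ _ _ C) => //; exact: coord_continuous.
Qed.

Lemma Ck_comp k m V U (W : set 'rV[R]_m) (f : 'rV[R]_n -> 'rV[R]_m) (g : 'rV[R]_m -> V) :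
  open U -> open W -> (forall x, U x -> W (f x)) -> Ck k U f -> Ck k W g ->
  Ck k U (g \o f).
Proof.
move=> oU oW UW; elim: k V g => [|k IH] V g.
  by move=> hf hg x Ux; apply: continuous_comp; [exact: hf|apply/hg/UW].
move=> hf hg; have [f1 f2] := hf; have [g1 g2] := hg.
have dgf x : U x -> differentiable (g \o f) x.
  by move=> Ux; apply: differentiable_comp; [exact: f1|apply/g1/UW].
split=> // v.
apply: (@Ck_eq _ _ _ (fun x => \sum_j ('D_v f x ord0 j) *: ('D_(delta_mx ord0 j) g \o f) x)) => //.
  move=> x /set_mem Ux /=; have df := f1 _ Ux; have dg := g1 _ (UW _ Ux).
  rewrite (deriveE _ (dgf _ Ux)) (diff_comp df dg) /= -(deriveE _ df).
  rewrite [X in 'd g _ X]row_sum_delta linear_sum.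
  by apply: eq_bigr => j _; rewrite linearZ (deriveE _ dg).
apply: Ck_sum => // j; apply: Ck_scale => //; first exact/Ck_coord/f2.
by apply: IH; [exact: CkS|exact: g2].
Qed.

End fixn.
End Calculus.

Section CinftyTheory.
Variables (R : realType) (n : nat).
Implicit Types (V : normedModType R) (U : set 'rV[R]_n).

Lemma Cinfty_sub V U U' (f : 'rV_n -> V) : U' `<=` U -> Cinfty U f -> Cinfty U' f.
Proof. by move=> UU h k; apply: Ck_sub UU (h k). Qed.

Lemma Cinfty_eq V U (f g : 'rV_n -> V) : open U -> (forall x, U x -> f x = g x) ->
  Cinfty U f -> Cinfty U g.
Proof. by move=> oU fg h k; apply: Ck_eq (h k) => // x /set_mem; apply: fg. Qed.

Lemma Cinfty_loc V U (f : 'rV_n -> V) :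
  (forall x, U x -> exists2 W, W x & Cinfty W f) -> Cinfty U f.
Proof. by move=> h k; apply: Ck_loc => x /h[W Wx c]; exists W. Qed.

Lemma Cinfty_comp m V U (W : set 'rV[R]_m) (f : 'rV[R]_n -> 'rV[R]_m)
    (g : 'rV[R]_m -> V) :
  open U -> open W -> (forall x, U x -> W (f x)) -> Cinfty U f -> Cinfty W g ->
  Cinfty U (g \o f).
Proof. by move=> oU oW UW hf hg k; apply: Ck_comp (hf k) (hg k). Qed.

Lemma Cinfty_differentiable V U (f : 'rV_n -> V) x :
  Cinfty U f -> U x -> differentiable f x.
Proof. by move=> /(_ 1) [+ _]; apply. Qed.

Lemma Cinfty_derive V U (f : 'rV_n -> V) v : Cinfty U f -> Cinfty U ('D_v f).
Proof. by move=> h k; have [_ /(_ v)] := h k.+1. Qed.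

End CinftyTheory.

Record chart (R : realType) (X : topologicalType) (n : nat) := Chart {
  cdom : set X;
  cmap : X -> 'rV[R]_n;
  cinv : 'rV[R]_n -> X;
  cdom_open : open cdom;
  cimg_open : open (cmap @` cdom);
  cmapK : forall x, cdom x -> cinv (cmap x) = x;
  cmap_continuous : forall x, cdom x -> {for x, continuous cmap};
  cinv_continuous : forall x, cdom x -> {for cmap x, continuous cinv} }.

(* The atlas need not be maximal. *)
Record manifold (R : realType) := Manifold {
  msort :> topologicalType;
  mdim : nat;
  atlas : set (chart R msort mdim);
  m_hausdorff : hausdorff_space msort;
  m_second_countable : @second_countable msort;
  m_cover : forall x, exists c, atlas c /\ cdom c x;
  m_compatible : forall c d, atlas c -> atlas d ->
    Cinfty (cmap c @` (cdom c `&` cdom d)) (cmap d \o cinv c) }.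

(* W is an open set; values outside W are irrelevant. *)
Definition smooth_on (R : realType) (M : manifold R) (V : normedModType R)
    (W : set M) (f : M -> V) : Prop :=
  forall c, atlas c -> Cinfty (cmap c @` (cdom c `&` W)) (f \o cinv c).

Section SmoothOn.
Variables (R : realType) (M : manifold R).
Implicit Types (V : normedModType R) (W : set M) (c d : chart R M (mdim M)).

Lemma chart_img_open c W : open W -> open (cmap c @` (cdom c `&` W)).
Proof.
move=> oW; rewrite openE => _ [x [cx Wx] <-]; rewrite /interior.
have cW : \forall y \near cmap c x, (cdom c `&` W) (cinv c y).
  have := cinv_continuous cx; rewrite /prop_for /continuous_at (cmapK cx); apply.
  by apply: open_nbhs_nbhs; split=> //; apply: openI => //; exact: cdom_open.
have cI : \forall y \near cmap c x, (cmap c @` cdom c) y.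
  by apply: open_nbhs_nbhs; split; [exact: cimg_open|exists x].
by apply: filterS2 cW cI => y /[swap] -[z cz <-]; rewrite cmapK // => h; exists z.
Qed.

Lemma smooth_on_sub V W W' (f : M -> V) : W' `<=` W -> smooth_on W f -> smooth_on W' f.
Proof.
move=> WW h c ac; apply: Cinfty_sub (h c ac) => _ [x [cx Wx] <-].
by exists x => //; split=> //; exact: WW.
Qed.

Lemma smooth_on_eq V W (f g : M -> V) : open W -> (forall x, W x -> f x = g x) ->
  smooth_on W f -> smooth_on W g.
Proof.
move=> oW fg h c ac; apply: Cinfty_eq (h c ac); first exact: chart_img_open.
by move=> _ [x [cx Wx] <-] /=; rewrite (cmapK cx) fg.
Qed.

(* Smoothness may be checked near each point, in one chart of our choice. *)
Lemma smooth_on_loc V W (f : M -> V) :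
  (forall x, W x -> exists c W', [/\ atlas c, cdom c x, open W', W' x &
     Cinfty (cmap c @` (cdom c `&` W')) (f \o cinv c)]) -> smooth_on W f.
Proof.
move=> h d ad; apply: Cinfty_loc => _ [x [dx Wx] <-].
have [c [W' [ac cx oW' W'x hc]]] := h x Wx.
pose O := cdom c `&` W'.
have oO : open O by apply: openI => //; exact: cdom_open.
exists (cmap d @` (cdom d `&` O)); first by exists x.
apply: (@Cinfty_eq _ _ _ _ ((f \o cinv c) \o (cmap c \o cinv d))).
- exact: chart_img_open.
- by move=> _ [y [dy [cy _]] <-] /=; rewrite (cmapK dy) (cmapK cy).
apply: Cinfty_comp hc.
- exact: chart_img_open.
- exact: chart_img_open.
- by move=> _ [y [dy Oy] <-] /=; rewrite (cmapK dy); exists y.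
apply: Cinfty_sub (m_compatible ad ac) => _ [y [dy [cy _]] <-].
by exists y.
Qed.

Lemma smooth_on_loc2 V W (f : M -> V) :
  (forall x, W x -> exists W', [/\ open W', W' x & smooth_on W' f]) -> smooth_on W f.
Proof.
move=> h; apply: smooth_on_loc => x /h[W' [oW W'x sf]].
by have [c [ac cx]] := m_cover x; exists c, W'; split=> //; exact: sf.
Qed.

Lemma smooth_on_chart d : atlas d -> smooth_on (cdom d) (cmap d).
Proof. by move=> ad c ac; exact: m_compatible. Qed.

Lemma smooth_on_cst V W (a : V) : smooth_on W (cst a).
Proof. by move=> c ac k; exact: (@Ck_cst R (mdim M) k V). Qed.

Lemma smooth_on_add V W (f g : M -> V) : open W ->
  smooth_on W f -> smooth_on W g -> smooth_on W (f \+ g).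
Proof.
move=> oW hf hg c ac k; apply: Ck_add; [exact: chart_img_open|exact: hf|exact: hg].
Qed.

Lemma smooth_on_sum V W (I : Type) (s : seq I) (f : I -> M -> V) : open W ->
  (forall i, smooth_on W (f i)) -> smooth_on W (fun x => \sum_(i <- s) f i x).
Proof.
move=> oW hf c ac k.
by apply: (@Ck_sum _ _ _ _ _ _ _ (fun i => f i \o cinv c));
  [exact: chart_img_open|move=> i; exact: hf].
Qed.

Lemma smooth_on_scale V W (a : M -> R) (f : M -> V) : open W ->
  smooth_on W a -> smooth_on W f -> smooth_on W (fun x => a x *: f x).
Proof.
move=> oW hf hg c ac k.
by apply: (@Ck_scale _ _ _ _ _ (a \o cinv c) (f \o cinv c));
  [exact: chart_img_open|exact: hf|exact: hg].
Qed.

Lemma smooth_on_coord m W (f : M -> 'rV[R]_m) i : open W ->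
  smooth_on W f -> smooth_on W (fun x => f x ord0 i : R).
Proof.
move=> oW hf c ac k; apply: (@Ck_coord _ _ _ _ _ (f \o cinv c)).
  exact: chart_img_open.
exact: hf.
Qed.

End SmoothOn.

Definition smooth_pred (R : realType) (M : manifold R) : {pred M -> R} :=
  [pred f : M -> R | `[< smooth_on setT f >]].
Arguments smooth_pred {R} M.

Record smooth_fun (R : realType) (M : manifold R) := SmoothFun {
  sfun :> M -> R;
  _ : sfun \in smooth_pred M }.

Section SmoothFun.
Variables (R : realType) (M : manifold R).
HB.instance Definition _ := [isSub for @sfun R M].
HB.instance Definition _ := gen_eqMixin (smooth_fun M).
HB.instance Definition _ := gen_choiceMixin (smooth_fun M).

Lemma smooth_predP (f : M -> R) : reflect (smooth_on setT f) (f \in smooth_pred M).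
Proof. by rewrite inE; exact: asboolP. Qed.

Lemma sfunP (f : smooth_fun M) : smooth_on setT f.
Proof. by case: f => f h; apply/smooth_predP. Qed.

Definition smoothF (f : M -> R) (h : smooth_on setT f) : smooth_fun M :=
  SmoothFun (introT (smooth_predP f) h).

Lemma sfun_ext (f g : smooth_fun M) : (forall x, f x = g x) -> f = g.
Proof. by move=> fg; apply/val_inj/funext. Qed.

Lemma smooth_subring : subring_closed (smooth_pred M).
Proof.
split=> [|f g /smooth_predP hf /smooth_predP hg|f g /smooth_predP hf /smooth_predP hg];
    apply/smooth_predP.
- exact: smooth_on_cst.
- have -> : f - g = f \+ (fun x => (-1 : R) *: (g x : R^o)).
    by apply/funext => x /=; rewrite scaleN1r.
  apply: smooth_on_add => //; first exact: openT.
  by apply: (@smooth_on_scale _ _ _ _ (cst (-1))) => //; [exact: openT|exact: smooth_on_cst].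
- by apply: (@smooth_on_scale _ _ _ _ f g) => //; exact: openT.
Qed.
HB.instance Definition _ := GRing.SubChoice_isSubComPzRing.Build
  (M -> R) (smooth_pred M) (smooth_fun M) smooth_subring.

Definition sconst (a : R) : smooth_fun M := smoothF (@smooth_on_cst R M R setT a).
End SmoothFun.
Record smooth_map (R : realType) (M N : manifold R) := SmoothMap {
  smap :> M -> N;
  smap_continuous : continuous smap;
  smap_smooth : forall d, atlas d -> smooth_on (smap @^-1` cdom d) (cmap d \o smap) }.

Section SmoothMap.
Variables (R : realType).
Implicit Types M N P : manifold R.

Lemma preim_open M N (h : smooth_map M N) (W : set N) : open W -> open (h @^-1` W).
Proof. by move=> oW; apply: open_comp => // x _; exact: smap_continuous. Qed.

Lemma smooth_on_comp M N (h : smooth_map M N) (V : normedModType R)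
    (W : set N) (f : N -> V) : open W ->
  smooth_on W f -> smooth_on (h @^-1` W) (f \o h).
Proof.
move=> oW hf; apply: smooth_on_loc => x Wx.
have [c [ac cx]] := m_cover x; have [d [ad dhx]] := m_cover (h x).
pose O := h @^-1` (cdom d `&` W).
have oO : open O by apply: preim_open; apply: openI => //; exact: cdom_open.
exists c, O; split=> //.
apply: (@Cinfty_eq _ _ _ _ ((f \o cinv d) \o ((cmap d \o h) \o cinv c))).
- exact: chart_img_open.
- by move=> _ [y [cy [dy _]] <-] /=; rewrite (cmapK cy) (cmapK dy).
apply: Cinfty_comp (hf d ad).
- exact: chart_img_open.
- exact: chart_img_open.
- by move=> _ [y [cy Oy] <-] /=; rewrite (cmapK cy); exists (h y).
apply: Cinfty_sub (smap_smooth h ad ac) => _ [y [cy [dy _]] <-].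
by exists y.
Qed.

Lemma comp_continuous_sub M N P (g : smooth_map N P) (f : smooth_map M N) :
  continuous (g \o f).
Proof. by move=> x; apply: continuous_comp; exact: smap_continuous. Qed.

Lemma comp_smooth_sub M N P (g : smooth_map N P) (f : smooth_map M N) d : atlas d ->
  smooth_on ((g \o f) @^-1` cdom d) (cmap d \o (g \o f)).
Proof.
move=> ad; apply: (@smooth_on_comp _ _ f _ (g @^-1` cdom d) (cmap d \o g)).
  by apply: preim_open; exact: cdom_open.
exact: smap_smooth.
Qed.

Definition smooth_comp M N P (g : smooth_map N P) (f : smooth_map M N) : smooth_map M P :=
  SmoothMap (@comp_continuous_sub _ _ _ g f) (@comp_smooth_sub _ _ _ g f).
End SmoothMap.

Record diffeo (R : realType) (M N : manifold R) := Diffeo {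
  diffeo_fun :> smooth_map M N;
  diffeo_inv : smooth_map N M;
  diffeoK : cancel diffeo_fun diffeo_inv;
  diffeo_invK : cancel diffeo_inv diffeo_fun }.
Arguments diffeoK {R M N} d x.
Arguments diffeo_invK {R M N} d x.

Definition diffeo_comp (R : realType) (M N P : manifold R)
    (g : diffeo N P) (f : diffeo M N) : diffeo M P :=
  @Diffeo R M P (smooth_comp g f) (smooth_comp (diffeo_inv f) (diffeo_inv g))
    (can_comp (diffeoK g) (diffeoK f)) (can_comp (diffeo_invK f) (diffeo_invK g)).

(* A vector bundle, presented by its fibres and by local trivialisations with
   smooth linear transition maps; the total space is {x : M & E x}, with the
   smooth structure for which the trivialisations are diffeomorphisms. *)
Record triv (R : realType) (M : manifold R) (E : M -> lmodType R) (k : nat) := Triv {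
  tdom : set M;
  tmap : forall x, E x -> 'rV[R]_k;
  tinv : forall x, 'rV[R]_k -> E x;
  tdom_open : open tdom;
  tmap_linear : forall x, tdom x -> linear (@tmap x);
  tmapK : forall x, tdom x -> cancel (@tmap x) (@tinv x);
  tinvK : forall x, tdom x -> cancel (@tinv x) (@tmap x) }.

Record vbundle (R : realType) (M : manifold R) := VBundle {
  fib :> M -> lmodType R;
  rank : nat;
  vatlas : set (triv fib rank);
  v_cover : forall x, exists t, vatlas t /\ tdom t x;
  v_compatible : forall s t, vatlas s -> vatlas t -> forall w,
    smooth_on (tdom s `&` tdom t) (fun x => tmap t (tinv s x w)) }.

Record section (R : realType) (M : manifold R) (E : vbundle M) := Section {
  sec :> forall x, E x;
  sec_smooth : forall t : triv E (rank E), vatlas t ->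
    smooth_on (tdom t) (fun x => tmap t (sec x)) }.

Section Sections.
Variables (R : realType) (M : manifold R).

Lemma smooth_on_apply k (V : normedModType R) (W : set M)
    (A : M -> 'rV[R]_k -> V) (a : M -> 'rV[R]_k) :
  open W -> (forall x, W x -> linear (A x)) -> (forall w, smooth_on W (A ^~ w)) ->
  smooth_on W a -> smooth_on W (fun x => A x (a x)).
Proof.
move=> oW lA sA sa.
apply: (@smooth_on_eq _ _ _ _ (fun x => \sum_j a x ord0 j *: A x (delta_mx ord0 j))) => //.
  move=> x Wx; pose m := GRing.isLinear.Build _ _ _ _ _ (lA x Wx).
  pose L : {linear 'rV[R]_k -> V} := HB.pack (A x) m.
  rewrite [in RHS](row_sum_delta (a x)) -[RHS]/(L _) linear_sum.
  by apply: eq_bigr => j _; rewrite linearZ.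
by apply: smooth_on_sum => // j; apply: smooth_on_scale => //; exact: smooth_on_coord.
Qed.

Variable E : vbundle M.
Implicit Types u v : section E.

Definition tlin (t : triv E (rank E)) x (tx : tdom t x) : {linear E x -> 'rV[R]_(rank E)} :=
  let m := GRing.isLinear.Build _ _ _ _ _ (@tmap_linear _ _ _ _ t x tx) in
  HB.pack (@tmap _ _ _ _ t x) m.

Lemma section_ext u v : (forall x, u x = v x) -> u = v.
Proof.
case: u v => [u su] [v sv] /= e.
have uv : u = v by exact: functional_extensionality_dep.
by subst v; congr Section; exact: Prop_irrelevance.
Qed.

Lemma sec_zero_smooth (t : triv E (rank E)) : vatlas t ->
  smooth_on (tdom t) (fun x => tmap t (0 : E x)).
Proof.
move=> vt; apply: (@smooth_on_eq _ _ _ _ (cst 0)); first exact: tdom_open.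
  by move=> x tx; rewrite -[RHS]/(tlin tx 0) linear0.
exact: smooth_on_cst.
Qed.

Lemma sec_lin_smooth (f : smooth_fun M) u v (t : triv E (rank E)) : vatlas t ->
  smooth_on (tdom t) (fun x => tmap t (f x *: u x + v x)).
Proof.
move=> vt; apply: (@smooth_on_eq _ _ _ _
  ((fun x => f x *: tmap t (u x)) \+ (fun x => tmap t (v x)))).
- exact: tdom_open.
- by move=> x tx; rewrite /= (tmap_linear tx).
have ot := tdom_open t.
apply: smooth_on_add; [exact: ot| |exact: sec_smooth].
apply: smooth_on_scale; [exact: ot| |exact: sec_smooth].
exact: smooth_on_sub (sfunP f).
Qed.

Definition sec_zero : section E := Section sec_zero_smooth.
Definition sec_lin f u v : section E := Section (sec_lin_smooth f u v).

HB.instance Definition _ := gen_eqMixin (section E).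
HB.instance Definition _ := gen_choiceMixin (section E).

Lemma sec_add_smooth u v (t : triv E (rank E)) (vt : vatlas t) :
  smooth_on (tdom t) (fun x => tmap t (u x + v x)).
Proof.
apply: smooth_on_eq (sec_lin_smooth 1 u v vt); first exact: tdom_open.
by move=> x _; rewrite scale1r.
Qed.
Lemma sec_scale_smooth (f : smooth_fun M) u (t : triv E (rank E)) (vt : vatlas t) :
  smooth_on (tdom t) (fun x => tmap t (f x *: u x)).
Proof.
apply: smooth_on_eq (sec_lin_smooth f u sec_zero vt); first exact: tdom_open.
by move=> x _ /=; rewrite addr0.
Qed.
Definition sec_add u v := Section (sec_add_smooth u v).
Definition sec_scale f u := Section (sec_scale_smooth f u).
Definition sec_opp u := sec_scale (-1) u.

Let addA : associative sec_add.
Proof. by move=> u v w; apply: section_ext => x /=; rewrite addrA. Qed.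
Let addC : commutative sec_add.
Proof. by move=> u v; apply: section_ext => x /=; rewrite addrC. Qed.
Let add0 : left_id sec_zero sec_add.
Proof. by move=> u; apply: section_ext => x /=; rewrite add0r. Qed.
Let addN : left_inverse sec_zero sec_opp sec_add.
Proof. by move=> u; apply: section_ext => x /=; rewrite scaleN1r addNr. Qed.
HB.instance Definition _ := GRing.isZmodule.Build (section E) addA addC add0 addN.

Let scaleA a b u : sec_scale a (sec_scale b u) = sec_scale (a * b) u.
Proof. by apply: section_ext => x /=; rewrite scalerA. Qed.
Let scale1 : left_id 1 sec_scale.
Proof. by move=> u; apply: section_ext => x /=; rewrite scale1r. Qed.
Let scaleDr : right_distributive sec_scale +%R.
Proof. by move=> a u v; apply: section_ext => x /=; rewrite scalerDr. Qed.
Let scaleDl u : {morph sec_scale^~ u : a b / a + b}.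
Proof. by move=> a b; apply: section_ext => x /=; rewrite scalerDl. Qed.
HB.instance Definition _ := GRing.Zmodule_isLmodule.Build (smooth_fun M) (section E)
  scaleA scale1 scaleDr scaleDl.

Lemma secD u v x : (u + v) x = u x + v x. Proof. by []. Qed.
Lemma secZ (f : smooth_fun M) u x : (f *: u) x = f x *: u x. Proof. by []. Qed.
End Sections.

Record vbmor (R : realType) (M N : manifold R) (E : vbundle M) (E' : vbundle N)
    (phi0 : smooth_map M N) := VBMor {
  vmap :> forall x, {linear E x -> E' (phi0 x)};
  vmap_smooth : forall (s : triv E (rank E)) (t : triv E' (rank E')),
    vatlas s -> vatlas t -> forall w,
    smooth_on (tdom s `&` (phi0 @^-1` tdom t))
      (fun x => tmap t (vmap x (tinv s x w))) }.

Section Morphisms.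
Variables (R : realType) (M N P : manifold R).
Variables (E : vbundle M) (E' : vbundle N) (E'' : vbundle P).

Lemma vbcomp_smooth (psi0 : smooth_map N P) (phi0 : smooth_map M N)
    (psi : vbmor E' E'' psi0) (phi : vbmor E E' phi0)
    (s : triv E (rank E)) (t : triv E'' (rank E'')) :
  vatlas s -> vatlas t -> forall w,
  smooth_on (tdom s `&` (smooth_comp psi0 phi0 @^-1` tdom t))
    (fun x => tmap t ((psi (phi0 x) \o phi x) (tinv s x w))).
Proof.
move=> vs vt w; apply: smooth_on_loc2 => x0 [sx tx].
have [r [vr rx]] := v_cover E' (phi0 x0).
pose W' := tdom r `&` (psi0 @^-1` tdom t).
have oW' : open W' by apply: openI; [exact: tdom_open|apply/preim_open/tdom_open].
pose W := tdom s `&` (phi0 @^-1` W').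
have oW : open W by apply: openI; [exact: tdom_open|exact: preim_open].
exists W; split=> //.
apply: (@smooth_on_eq _ _ _ _ (fun x => (fun z => tmap t (psi (phi0 x) (tinv r (phi0 x) z)))
   (tmap r (phi x (tinv s x w))))) => //.
  by move=> x [_ [rx' _]] /=; rewrite tmapK.
apply: (@smooth_on_apply _ _ _ _ _ (fun x z => tmap t (psi (phi0 x) (tinv r (phi0 x) z)))) => //.
- move=> x [_ [rx' tx']] a y z.
  rewrite -(tmap_linear tx') -linearP; congr (tmap t (psi _ _)).
  by rewrite -[RHS](tmapK rx') (tmap_linear rx') !tinvK.
- move=> z; apply: (@smooth_on_sub _ _ _ (phi0 @^-1` W')); first by move=> ? [].
  exact: (@smooth_on_comp R _ _ phi0 _ _ (fun y => tmap t (psi y (tinv r y z))) oW'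
    (vmap_smooth psi vr vt z)).
- by apply: smooth_on_sub (vmap_smooth phi vs vr w) => x [? []].
Qed.

Definition vbcomp (psi0 : smooth_map N P) (phi0 : smooth_map M N)
    (psi : vbmor E' E'' psi0) (phi : vbmor E E' phi0) :
    vbmor E E'' (smooth_comp psi0 phi0) :=
  @VBMor R M P E E'' (smooth_comp psi0 phi0)
    (fun x => GRing.Linear.clone _ _ _ _ (psi (phi0 x) \o phi x) _)
    (@vbcomp_smooth _ _ psi phi).

(* Gamma(phi, phi0) u = phi o u o phi0^-1; the cast is along
   phi0 (phi0^-1 y) = y. *)
Definition Gamma_fun (phi0 : diffeo M N) (phi : vbmor E E' phi0) (u : section E)
    (y : N) : E' y :=
  eq_rect _ (fun y => E' y) (phi _ (u (diffeo_inv phi0 y))) y (diffeo_invK phi0 y).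

Lemma Gamma_smooth (phi0 : diffeo M N) (phi : vbmor E E' phi0) (u : section E)
    (t : triv E' (rank E')) : vatlas t ->
  smooth_on (tdom t) (fun y => tmap t (Gamma_fun phi u y)).
Proof.
move=> vt; pose W := phi0 @^-1` tdom t.
have ot := tdom_open t.
have oW : open W by exact: preim_open.
have sW : smooth_on W (fun x => tmap t (phi x (u x))).
  apply: smooth_on_loc2 => x0 tx0; have [s [vs sx]] := v_cover E x0.
  have oW' : open (tdom s `&` W) by apply: openI => //; exact: tdom_open.
  exists (tdom s `&` W); split=> //.
  apply: (@smooth_on_eq _ _ _ _ (fun x => (fun z => tmap t (phi x (tinv s x z)))
     (tmap s (u x)))) => //.
    by move=> x [sx' _] /=; rewrite tmapK.
  apply: (@smooth_on_apply _ _ _ _ _ (fun x z => tmap t (phi x (tinv s x z)))) => //.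
  - move=> x [sx' tx'] a y z.
    rewrite -(tmap_linear tx') -linearP; congr (tmap t (phi _ _)).
    by rewrite -[RHS](tmapK sx') (tmap_linear sx') !tinvK.
  - exact: vmap_smooth.
  - by apply: smooth_on_sub (sec_smooth u vs) => x [].
have := @smooth_on_comp _ _ _ (diffeo_inv phi0) _ _ _ oW sW.
rewrite (_ : _ @^-1` W = tdom t); last first.
  by apply/seteqP; split=> y; rewrite /W /preimage /= diffeo_invK.
apply: smooth_on_eq => // y _; rewrite /Gamma_fun /=.
by move: (phi _ _) (diffeo_invK phi0 y); move: (phi0 _) => y' e p; subst y'.
Qed.

Definition Gamma (phi0 : diffeo M N) (phi : vbmor E E' phi0) (u : section E) :
  section E' := Section (Gamma_smooth phi u).

Lemma GammaE (phi0 : diffeo M N) (phi : vbmor E E' phi0) (u : section E) x :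
  Gamma phi u (phi0 x) = phi x (u x).
Proof.
rewrite /= /Gamma_fun; move: (diffeo_invK phi0 (phi0 x)).
move: (diffeo_inv phi0 (phi0 x)) (diffeoK phi0 x) => x' ->  p.
by rewrite (Prop_irrelevance p erefl).
Qed.

End Morphisms.

Definition chart_at (R : realType) (M : manifold R) (x : M) : chart R M (mdim M) :=
  projT1 (cid (m_cover x)).

(* The differential at x of f : M -> V read in the chart c. *)
Definition cdiff (R : realType) (M : manifold R) (V : normedModType R)
    (c : chart R M (mdim M)) (f : M -> V) (x : M) : {linear 'rV[R]_(mdim M) -> V} :=
  'd (f \o cinv c) (cmap c x).

(* A tangent vector at x is represented by its coordinates in chart_at x. *)
Definition tangent_space (R : realType) (M : manifold R) (x : M) : lmodType R :=
  'rV[R]_(mdim M).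

(* df_x(v), i.e. the derivative of f along v *)
Definition tderiv (R : realType) (M : manifold R) (V : normedModType R)
    (f : M -> V) (x : M) : {linear tangent_space x -> V} := cdiff (chart_at x) f x.

Section Tangent.
Variables (R : realType).
Implicit Types (M N : manifold R) (V : normedModType R).

Lemma chart_at_atlas M (x : M) : atlas (chart_at x).
Proof. by rewrite /chart_at; case: cid => c []. Qed.

Lemma chart_at_dom M (x : M) : cdom (chart_at x) x.
Proof. by rewrite /chart_at; case: cid => c []. Qed.

Lemma smooth_chart_diff M V (W : set M) (f : M -> V) c x : atlas c -> cdom c x ->
  W x -> smooth_on W f -> differentiable (f \o cinv c) (cmap c x).
Proof. by move=> ac cx Wx hf; apply: Cinfty_differentiable (hf c ac) _; exists x. Qed.

Lemma cdiff_chain M N (h : smooth_map M N) V (W : set N) (f : N -> V) c d x v :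
  atlas c -> atlas d -> cdom c x -> cdom d (h x) -> open W -> W (h x) -> smooth_on W f ->
  cdiff d f (h x) (cdiff c (cmap d \o h) x v) = cdiff c (f \o h) x v.
Proof.
move=> ac ad cx dhx oW Wx hf; rewrite /cdiff.
have d1 : differentiable ((cmap d \o h) \o cinv c) (cmap c x).
  by apply: (smooth_chart_diff ac cx _ (smap_smooth h ad)).
have e1 : ((cmap d \o h) \o cinv c) (cmap c x) = cmap d (h x) by rewrite /= cmapK.
have d2 := smooth_chart_diff ad dhx Wx hf.
rewrite -e1 in d2 *.
have := diff_comp d1 d2 => /(congr1 (@^~ v)) /= <-.
have dfh : differentiable ((f \o h) \o cinv c) (cmap c x).
  apply: (@smooth_chart_diff M V (h @^-1` W) (f \o h)) => //.
  exact: smooth_on_comp.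
rewrite -!deriveE //; last exact: differentiable_comp.
apply: near_eq_derive.
have o : open (cmap c @` (cdom c `&` (h @^-1` cdom d))).
  by apply: chart_img_open; apply: preim_open; exact: cdom_open.
have nb : nbhs (cmap c x) (cmap c @` (cdom c `&` (h @^-1` cdom d))).
  by apply: open_nbhs_nbhs; split=> //; exists x.
apply: filterS nb.
by move=> _ [y [cy dy] <-] /=; rewrite (cmapK cy) (cmapK dy).
Qed.

Definition smooth_id M : smooth_map M M :=
  SmoothMap (fun x => @cvg_id _ (nbhs x)) (fun d ad => smooth_on_chart ad).

Lemma cdiff_change M V (W : set M) (f : M -> V) c d x v :
  atlas c -> atlas d -> cdom c x -> cdom d x -> open W -> W x -> smooth_on W f ->
  cdiff d f x (cdiff c (cmap d) x v) = cdiff c f x v.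
Proof. by move=> ac ad cx dx; exact: (cdiff_chain (h := smooth_id M)). Qed.

Lemma cdiff_chart M c (x : M) v : atlas c -> cdom c x -> cdiff c (cmap c) x v = v.
Proof.
move=> ac cx; rewrite /cdiff -deriveE; last exact: (smooth_chart_diff ac cx cx (smooth_on_chart ac)).
rewrite -[RHS](@derive_id _ _ (cmap c x) v); apply: near_eq_derive.
have nb : nbhs (cmap c x) (cmap c @` cdom c).
  by apply: open_nbhs_nbhs; split; [exact: cimg_open|exists x].
apply: filterS nb.
by move=> _ [y cy <-] /=; rewrite (cmapK cy).
Qed.

Lemma cdiff_smooth M V (W : set M) (f : M -> V) c v : atlas c -> open W -> smooth_on W f ->
  smooth_on (cdom c `&` W) (fun x => cdiff c f x v).
Proof.
move=> ac oW hf; apply: smooth_on_loc => x [cx Wx]; exists c, W; split=> //.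
apply: Cinfty_eq (Cinfty_derive v (hf c ac)); first exact: chart_img_open.
move=> _ [y [cy Wy] <-] /=; rewrite /cdiff (cmapK cy) deriveE //.
exact: smooth_chart_diff hf.
Qed.

Section TangentBundle.
Variable M : manifold R.

Section Triv.
Variables (c : chart R M (mdim M)) (ac : atlas c).

Definition tan_map (x : M) (v : tangent_space x) : 'rV[R]_(mdim M) := tderiv (cmap c) x v.
Definition tan_inv (x : M) (w : 'rV[R]_(mdim M)) : tangent_space x :=
  cdiff c (cmap (chart_at x)) x w.

Lemma tan_linear x : cdom c x -> linear (@tan_map x).
Proof. by move=> _ a u v; rewrite /tan_map linearP. Qed.

Lemma tan_mapK x : cdom c x -> cancel (@tan_map x) (@tan_inv x).
Proof.
move=> cx v; rewrite /tan_inv /tan_map /tderiv.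
have [ax dx] := (chart_at_atlas x, chart_at_dom x).
rewrite (cdiff_change v ax ac dx cx (cdom_open _) dx (smooth_on_chart ax)).
exact: cdiff_chart.
Qed.

Lemma tan_invK x : cdom c x -> cancel (@tan_inv x) (@tan_map x).
Proof.
move=> cx v; rewrite /tan_inv /tan_map /tderiv.
have [ax dx] := (chart_at_atlas x, chart_at_dom x).
rewrite (cdiff_change v ac ax cx dx (cdom_open _) cx (smooth_on_chart ac)).
exact: cdiff_chart.
Qed.

Definition tan_triv : triv (@tangent_space R M) (mdim M) :=
  Triv (cdom_open c) tan_linear tan_mapK tan_invK.
End Triv.

Definition tan_atlas : set (triv (@tangent_space R M) (mdim M)) :=
  [set t | exists c (ac : atlas c), t = tan_triv ac].

Lemma tan_cover x : exists t, tan_atlas t /\ tdom t x.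
Proof.
have ax := chart_at_atlas x; exists (tan_triv ax); split; last exact: chart_at_dom.
by exists (chart_at x), ax.
Qed.

Lemma tan_compatible s t : tan_atlas s -> tan_atlas t -> forall w,
  smooth_on (tdom s `&` tdom t) (fun x => tmap t (tinv s x w)).
Proof.
move=> [c [ac ->]] [d [ad ->]] w /=.
have [oc od] := (cdom_open c, cdom_open d).
apply: smooth_on_eq (cdiff_smooth w ac od (smooth_on_chart ad)); first exact: openI.
move=> x [cx dx]; rewrite /tan_map /tan_inv /tderiv.
have [ax hx] := (chart_at_atlas x, chart_at_dom x).
exact/esym/(cdiff_change w ac ax cx hx od dx (smooth_on_chart ad)).
Qed.

Definition tangent_bundle : vbundle M := VBundle tan_cover tan_compatible.
End TangentBundle.

Section TangentMap.
Variables (M N : manifold R) (h : smooth_map M N).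

Definition tangent_map_fun (x : M) : {linear tangent_space x -> tangent_space (h x)} :=
  tderiv (cmap (chart_at (h x)) \o h) x.

Lemma tangent_map_smooth (s : triv (tangent_bundle M) (rank (tangent_bundle M)))
    (t : triv (tangent_bundle N) (rank (tangent_bundle N))) :
  vatlas s -> vatlas t -> forall w,
  smooth_on (tdom s `&` (h @^-1` tdom t)) (fun x => tmap t (tangent_map_fun x (tinv s x w))).
Proof.
move=> [c [ac ->]] [d [ad ->]] w /=.
have oc := cdom_open c; have od := cdom_open d.
have ohd := @preim_open _ _ _ h _ od; have sd := smap_smooth h ad.
apply: smooth_on_eq (cdiff_smooth w ac ohd sd); first exact: openI.
move=> x [cx dx]; rewrite /tan_map /tan_inv /tangent_map_fun /tderiv.
have [ax hx] := (chart_at_atlas x, chart_at_dom x).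
have [ay hy] := (chart_at_atlas (h x), chart_at_dom (h x)).
have e1 := cdiff_change w ac ax cx hx (@preim_open _ _ _ h _ (cdom_open _)) hy (smap_smooth h ay).
have e2 := cdiff_chain w ac ay cx hy od dx (smooth_on_chart ad).
exact: esym (etrans (congr1 (cdiff (chart_at (h x)) (cmap d) (h x)) e1) e2).
Qed.

Definition tangent_map : vbmor (tangent_bundle M) (tangent_bundle N) h :=
  VBMor tangent_map_smooth.
End TangentMap.

Section VectorFields.
Variable N : manifold R.
Implicit Types (X Y : section (tangent_bundle N)) (f g : smooth_fun N).

Lemma vf_act_smooth X f : smooth_on setT (fun x => tderiv f x (X x) : R^o).
Proof.
apply: smooth_on_loc2 => x0 _; have [c [ac cx0]] := m_cover x0.
have oc := cdom_open c; exists (cdom c); split=> //.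
apply: (@smooth_on_eq R N R^o (cdom c) (fun x => cdiff c (f : N -> R^o) x (tan_map c (X x))) _ oc).
  move=> x cx; have [ax hx] := (chart_at_atlas x, chart_at_dom x).
  exact: (@cdiff_change N R^o setT f _ _ _ _ ax ac hx cx openT I (sfunP f)).
apply: (@smooth_on_apply R N _ R^o (cdom c) (fun x => cdiff c (f : N -> R^o) x) _ oc).
- by move=> x _ a u v; exact: linearP.
- by move=> w; have := @cdiff_smooth N R^o setT f c w ac openT (sfunP f); rewrite setIT.
- by apply: (@sec_smooth _ _ _ X (tan_triv ac)); exists c, ac.
Qed.

Definition vf_act X f : smooth_fun N := smoothF (vf_act_smooth X f).

(* Z = [X, Y]_TN: the bracket of vector fields is the commutator of the
   derivations they induce on F(N). *)
Definition is_lie_bracket X Y Z :=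
  forall f, vf_act Z f = vf_act X (vf_act Y f) - vf_act Y (vf_act X f).
End VectorFields.
End Tangent.

Section Derivation.
Variables (R : realType) (N : manifold R) (X : section (tangent_bundle N)).
Implicit Types f g : smooth_fun N.

Lemma sfun_diff f x : differentiable (f \o cinv (chart_at x)) (cmap (chart_at x) x).
Proof.
exact: (@smooth_chart_diff R N R^o setT f _ _ (chart_at_atlas x) (chart_at_dom x) I (sfunP f)).
Qed.

Lemma vf_actE f x :
  vf_act X f x = 'D_(X x) (f \o cinv (chart_at x)) (cmap (chart_at x) x).
Proof. by rewrite (deriveE _ (sfun_diff f x)). Qed.

Lemma vf_actD f g : vf_act X (f + g) = vf_act X f + vf_act X g.
Proof.
apply: sfun_ext => x; rewrite -[RHS]/(vf_act X f x + vf_act X g x) !vf_actE.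
exact: (deriveD (diff_derivable (sfun_diff f x)) (diff_derivable (sfun_diff g x))).
Qed.

Lemma vf_actM f g : vf_act X (f * g) = vf_act X f * g + f * vf_act X g.
Proof.
apply: sfun_ext => x.
rewrite -[RHS]/(vf_act X f x * g x + f x * vf_act X g x) !vf_actE.
have [_ /(_ (X x)) e] := diff_scale (sfun_diff f x) (sfun_diff g x).
by rewrite -[LHS]/('D_(X x) _ _) [LHS]e /= (cmapK (chart_at_dom x)).
Qed.

Lemma vf_act0 : vf_act X 0 = 0.
Proof. by apply: (addrI (vf_act X 0)); rewrite -vf_actD !addr0. Qed.

Lemma vf_actN f : vf_act X (- f) = - vf_act X f.
Proof. by apply/eqP; rewrite -addr_eq0 -vf_actD addNr vf_act0. Qed.

Lemma vf_act_sign (b : bool) f : vf_act X ((-1) ^+ b * f) = (-1) ^+ b * vf_act X f.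
Proof. by case: b; rewrite ?expr0 ?expr1 ?mul1r // !mulN1r vf_actN. Qed.
End Derivation.

(* Gamma(Th o rho, h o eta) *)
Definition anchor (R : realType) (M N : manifold R) (h : diffeo M N) (eta : diffeo N M)
    (F : vbundle N) (rho : vbmor F (tangent_bundle M) eta) :
    section F -> section (tangent_bundle N) :=
  @Gamma R N N F (tangent_bundle N) (diffeo_comp h eta) (vbcomp (tangent_map h) rho).

(* A Lie F(N)-algebra is an F(N)-module with a Lie bracket; the bracket is
   bilinear over the constants only, as the Leibniz rule below forces. *)
Definition is_lie_algebra (R : realType) (N : manifold R) (F : vbundle N)
    (br : section F -> section F -> section F) : Prop :=
  [/\ forall (a : R) u v w, br (sconst N a *: u + v) w = sconst N a *: br u w + br v w,
      forall (a : R) u v w, br w (sconst N a *: u + v) = sconst N a *: br w u + br w v,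
      forall u, br u u = 0 &
      forall u v w, br u (br v w) + br v (br w u) + br w (br u v) = 0].

(* Morphisms for the three operations (+, ., [,]). *)
Definition is_lie_morphism (R : realType) (N : manifold R) (F : vbundle N)
    (br : section F -> section F -> section F)
    (T : section F -> section (tangent_bundle N)) : Prop :=
  [/\ forall u v, T (u + v) = T u + T v,
      forall (f : smooth_fun N) u, T (f *: u) = f *: T u &
      forall u v, is_lie_bracket (T u) (T v) (T (br u v))].

Record gen_lie_algebroid (R : realType) (M N : manifold R) := GenLieAlgebroid {
  gla_h : diffeo M N;
  gla_eta : diffeo N M;
  gla_F : vbundle N;
  gla_rho : vbmor gla_F (tangent_bundle M) gla_eta;
  gla_br : section gla_F -> section gla_F -> section gla_F;
  gla_leibniz : forall u v (f : smooth_fun N),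
    gla_br u (f *: v) = f *: gla_br u v + vf_act (anchor gla_h gla_rho u) f *: v;
  gla_lie : is_lie_algebra gla_br;
  gla_morphism : is_lie_morphism gla_br (anchor gla_h gla_rho) }.

Section Forms.
Variables (R : realType) (M N : manifold R) (A : gen_lie_algebroid M N).
Local Notation Gam := (section (gla_F A)).
Local Notation FN := (smooth_fun N).

Definition gla_anchor : Gam -> section (tangent_bundle N) :=
  anchor (gla_h A) (gla_rho A).

Definition upd q (z : 'I_q -> Gam) (i : 'I_q) (u : Gam) : 'I_q -> Gam :=
  fun j => if j == i then u else z j.

Definition multilinear q (w : ('I_q -> Gam) -> FN) : Prop :=
  forall z i (f : FN) u v, w (upd z i (f *: u + v)) = f * w (upd z i u) + w (upd z i v).

Definition alternating q (w : ('I_q -> Gam) -> FN) : Prop :=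
  forall z (s : 'S_q), w (fun i => z (s i)) = (-1) ^+ s * w z.

Definition form_pred q : {pred ('I_q -> Gam) -> FN} :=
  [pred w | `[< multilinear w /\ alternating w >]].
Arguments form_pred : clear implicits.

(* Lambda^q. For q = 0 both conditions are void and a form is determined by its
   value at the unique family 'I_0 -> Gamma(F), so that Lambda^0 = F(N). *)
Record altform q := Form {
  fval :> ('I_q -> Gam) -> FN;
  _ : fval \in form_pred q }.
HB.instance Definition _ q := [isSub for @fval q].
HB.instance Definition _ q := gen_eqMixin (altform q).
HB.instance Definition _ q := gen_choiceMixin (altform q).

Lemma form_predP q (w : ('I_q -> Gam) -> FN) :
  reflect (multilinear w /\ alternating w) (w \in form_pred q).
Proof. exact: asboolP. Qed.

Lemma formP q (w : altform q) : multilinear w /\ alternating w.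
Proof. by case: w => w h; apply/form_predP. Qed.

Definition mkform q (w : ('I_q -> Gam) -> FN) (h : multilinear w /\ alternating w) : altform q :=
  Form (introT (form_predP w) h).

Lemma form_submod q : @submod_closed FN (('I_q -> Gam) -> FN^o) (form_pred q).
Proof.
split=> [|a w w' /form_predP[m1 a1] /form_predP[m2 a2]]; apply/form_predP.
  split=> [z i f u v|z s].
    by rewrite -![(0 : _ -> FN^o) _]/(0 : FN) mulr0 addr0.
  by rewrite -![(0 : _ -> FN^o) _]/(0 : FN) mulr0.
split=> [z i f u v|z s].
  rewrite -![(a *: w + w') _]/(a * w _ + w' _) m1 m2 !mulrDr mulrCA.
  by rewrite -!addrA; congr (_ + _); rewrite addrCA.
by rewrite -![(a *: w + w') _]/(a * w _ + w' _) a1 a2 mulrCA -mulrDr.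
Qed.
HB.instance Definition _ q := GRing.SubChoice_isSubLmodule.Build FN
  (('I_q -> Gam) -> FN^o) (form_pred q) (altform q) (form_submod q).

Definition Lie_fun (z : Gam) q (w : altform q) (zs : 'I_q -> Gam) : FN :=
  vf_act (gla_anchor z) (w zs) - \sum_(i < q) w (upd zs i (gla_br z (zs i))).

Lemma upd_same q (z : 'I_q -> Gam) i u v : upd (upd z i u) i v = upd z i v.
Proof. by apply/funext => j; rewrite /upd; case: eqP. Qed.

Lemma upd_swap q (z : 'I_q -> Gam) i j u v : i != j ->
  upd (upd z i u) j v = upd (upd z j v) i u.
Proof.
move=> ij; apply/funext => k; rewrite /upd; case: (eqVneq k j) => // ->.
by rewrite eq_sym (negbTE ij).
Qed.

Lemma Lie_fun_form z q (w : altform q) : multilinear (Lie_fun z w) /\ alternating (Lie_fun z w).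
Proof.
have [ml al] := formP w; split=> [zs k f u v|zs s]; rewrite /Lie_fun.
  rewrite ml vf_actD vf_actM !(bigD1 k (P := xpredT)) //= !upd_same.
  have updk t : upd zs k t k = t by rewrite /upd eqxx.
  rewrite !updk.
  have [_ brD _ _] := gla_lie A.
  have -> : gla_br z (f *: u + v) = f *: gla_br z u + (vf_act (gla_anchor z) f *: u + gla_br z v).
    have := brD 1 (f *: u) v z; have s1 : sconst N 1 = 1 by exact: sfun_ext.
    by rewrite s1 !scale1r => ->; rewrite gla_leibniz addrA.
  rewrite !ml.
  have -> : \sum_(i < q | i != k) w (upd (upd zs k (f *: u + v)) i
      (gla_br z (upd zs k (f *: u + v) i))) =
    f * \sum_(i < q | i != k) w (upd (upd zs k u) i (gla_br z (upd zs k u i))) +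
    \sum_(i < q | i != k) w (upd (upd zs k v) i (gla_br z (upd zs k v i))).
    rewrite mulr_sumr -big_split /=; apply: eq_bigr => i ik.
    rewrite !(upd_swap _ _ _ (i := k)) 1?eq_sym // ml.
    by rewrite /upd (negbTE ik).
  set S1 := \sum_(i < q | _) _; set S2 := \sum_(i < q | _) _.
  set a := w _; set b := w _; set c := w _; set d := w _.
  rewrite mulrBr mulrDr !opprD.
  by rewrite [LHS](AC (3*((1*2)*2)) ((1*5)*((2*(4*7))*(3*(6*8))))) /= subrr add0r.
rewrite al vf_act_sign mulrBr mulr_sumr; congr (_ - _).
rewrite (reindex_inj (@perm_inj _ s^-1%g)) /=.
apply: eq_bigr => i _; rewrite -al; congr (w _); apply/funext => j.
by rewrite /upd permKV (can2_eq (permK s) (permKV s)).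
Qed.

Definition Lie_der z q (w : altform q) : altform q := mkform (Lie_fun_form z w).

Definition cons_fam q (z : Gam) (zs : 'I_q -> Gam) : 'I_q.+1 -> Gam :=
  fun i => if unlift ord0 i is Some j then zs j else z.

Lemma iprod_form z q (w : altform q.+1) :
  multilinear (fun zs => w (cons_fam z zs)) /\ alternating (fun zs => w (cons_fam z zs)).
Proof.
have [ml al] := formP w; split=> [zs i f u v|zs s].
  have e t : cons_fam z (upd zs i t) = upd (cons_fam z zs) (lift ord0 i) t.
    apply/funext => j; rewrite /cons_fam /upd.
    case: unliftP => [k|] ->; first by rewrite (inj_eq lift_inj).
    by rewrite (negbTE (neq_lift _ _)).
  by rewrite !e ml.
have -> : cons_fam z (fun i => zs (s i)) = fun i => cons_fam z zs (lift_perm ord0 ord0 s i).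
  apply/funext => j; rewrite /cons_fam; case: unliftP => [k|] ->.
    by rewrite lift_perm_lift liftK.
  by rewrite lift_perm_id unlift_none.
by rewrite al odd_lift_perm.
Qed.

(* i_z in positive degree *)
Definition iprod z q (w : altform q.+1) : altform q := mkform (iprod_form z w).

(* [z_i, z_j], z_0, ..., z_q with z_i and z_j omitted (i <> j) *)
Definition bracket_args q (z : 'I_q.+1 -> Gam) (i j : 'I_q.+1) : 'I_q -> Gam :=
  fun k => nth 0 (gla_br (z i) (z j) ::
    [seq z l | l <- enum 'I_q.+1 & l \notin [:: i; j]]) k.

Definition d_fun q (w : altform q) (z : 'I_q.+1 -> Gam) : FN :=
  \sum_(i < q.+1) (-1) ^+ i * vf_act (gla_anchor (z i)) (w (fun k => z (lift i k)))
  + \sum_(i < q.+1) \sum_(j < q.+1 | (i < j)%N)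
      (-1) ^+ (i + j) * w (bracket_args z i j).

(* d o i_z on Lambda^q; i_z vanishes on Lambda^0 *)
Definition d_iprod (d : forall q, altform q -> altform q.+1) (z : Gam) (q : nat) :
    altform q -> altform q :=
  match q with
  | 0 => fun=> 0
  | q'.+1 => fun w => d q' (iprod z w)
  end.

Definition cartan (d : forall q, altform q -> altform q.+1) : Prop :=
  forall z q (w : altform q), Lie_der z w = d_iprod d z w + iprod z (d q w).
End Forms.

(* Main.v *)
(** Cartan's formula expresses [d w] on [(z, z_1, ..., z_q)] through [L_z w]
    and [d (i_z w)], both evaluated at [(z_1, ..., z_q)].  Read as a recursion on
    the degree it yields uniqueness at once.  It also yields, by induction on the
    degree, that [d w] is a form: it is multilinear and alternating in all
    arguments but the first, and exchanging the first two arguments changes the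
    sign because [L_a i_b - i_b L_a = i_[a, b]] and [[a, b] = - [b, a]]. *)
Require Import Defs.
From HB Require Import structures.
From mathcomp Require Import all_boot all_order all_algebra all_fingroup.
From mathcomp Require Import all_classical all_reals all_analysis.

Set Implicit Arguments.
Unset Strict Implicit.
Unset Printing Implicit Defensive.

Import Order.TTheory GRing.Theory Num.Theory.
Import numFieldNormedType.Exports.
Local Open Scope ring_scope.

(** * Enumerations of ordinals and sums over pairs of indices *)

Lemma filter_neq_enum_ord n (j : 'I_n.+1) :
  [seq l <- enum 'I_n.+1 | l != j] = [seq lift j k | k <- enum 'I_n].
Proof.
(* As lists of naturals both sides are strictly increasing, so equality reduces to having the same
   elements. *)
apply: (inj_map val_inj); apply: (irr_sorted_eq ltn_trans ltnn).
- rewrite sorted_map; apply: sorted_filter; first by move=> ? ? ?; exact: ltn_trans.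
  by rewrite -sorted_map val_enum_ord iota_ltn_sorted.
- rewrite sorted_map sorted_map.
  have := iota_ltn_sorted 0 n; rewrite -val_enum_ord sorted_map.
  by apply: sub_sorted => a b /= ab; rewrite ltnNge leq_bump2 -ltnNge.
move=> x; apply/mapP/mapP => -[l hl ->].
  move: hl; rewrite mem_filter; case: (unliftP j l) => [k|] -> //; last by rewrite eqxx.
  by exists (lift j k) => //; apply: map_f; rewrite mem_enum.
exists l => //; case/mapP: hl => k _ ->.
by rewrite mem_filter eq_sym neq_lift mem_enum.
Qed.

(** Pairs [i < j] have either [i = 0] or both indices positive; this lemma and the next reindex the
    two kinds. *)
Lemma sum_ord_gt0 (V : nmodType) n (F : 'I_n.+1 -> V) :
  \sum_(j < n.+1 | (@ord0 n < j)%N) F j = \sum_(j < n) F (lift ord0 j).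
Proof. by rewrite big_mkcond big_ord_recl /= add0r. Qed.

Lemma sum_ord_gt_lift (V : nmodType) n (i : 'I_n) (F : 'I_n.+1 -> V) :
  \sum_(j < n.+1 | (lift ord0 i < j)%N) F j =
  \sum_(j < n | (i < j)%N) F (lift ord0 j).
Proof. by rewrite big_mkcond big_ord_recl /= add0r [RHS]big_mkcond. Qed.

(** * Vector fields acting on smooth functions *)

Section SmoothFunctions.
Variables (R : realType) (N : manifold R).
Implicit Types (X Y : section (tangent_bundle N)) (f g : smooth_fun N).

Lemma sconst1 : sconst N 1 = 1.
Proof. exact: sfun_ext. Qed.

Lemma vf_act_sconst X (a : R) : vf_act X (sconst N a) = 0.
Proof.
apply: sfun_ext => x; rewrite vf_actE.
by rewrite -[_ \o _]/(cst a) derive_cst.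
Qed.

Lemma vf_actZ X (a : R) f : vf_act X (sconst N a * f) = sconst N a * vf_act X f.
Proof. by rewrite vf_actM vf_act_sconst mul0r add0r. Qed.

Lemma vf_act_linl f X Y g : vf_act (f *: X + Y) g = f * vf_act X g + vf_act Y g.
Proof.
apply: sfun_ext => x.
rewrite -[LHS]/(tderiv g x (f x *: X x + Y x)).
by rewrite -[RHS]/(f x *: tderiv g x (X x) + tderiv g x (Y x)) linearP.
Qed.
End SmoothFunctions.

(** * Families with a distinguished first argument *)

Section ConsFam.
Variables (R : realType) (M N : manifold R) (A : gen_lie_algebroid M N).
Local Notation Gam := (section (gla_F A)).
Implicit Types (u v z : Gam).

Lemma cons_fam0 q z (zs : 'I_q -> Gam) : cons_fam z zs ord0 = z.
Proof. by rewrite /cons_fam unlift_none. Qed.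

Lemma cons_fam_lift q z (zs : 'I_q -> Gam) k : cons_fam z zs (lift ord0 k) = zs k.
Proof. by rewrite /cons_fam liftK. Qed.

Lemma cons_fam_comp_lift q z (zs : 'I_q -> Gam) :
  (fun k => cons_fam z zs (lift ord0 k)) = zs.
Proof. by apply/funext => k; rewrite cons_fam_lift. Qed.

Lemma cons_famP q (zs : 'I_q.+1 -> Gam) : exists u us, zs = cons_fam u us.
Proof.
exists (zs ord0), (fun k => zs (lift ord0 k)); apply/funext => k.
by case: (unliftP ord0 k) => [j|] ->; rewrite ?cons_fam_lift ?cons_fam0.
Qed.

Lemma upd_cons_fam0 q z u (zs : 'I_q -> Gam) :
  upd (cons_fam z zs) ord0 u = cons_fam u zs.
Proof.
apply/funext => k; rewrite /upd.
by case: (unliftP ord0 k) => [j|] ->; rewrite ?cons_fam_lift ?cons_fam0.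
Qed.

Lemma upd_cons_fam_lift q z u (zs : 'I_q -> Gam) i :
  upd (cons_fam z zs) (lift ord0 i) u = cons_fam z (upd zs i u).
Proof.
apply/funext => k; rewrite /upd.
by case: (unliftP ord0 k) => [j|] ->; rewrite ?cons_fam_lift ?cons_fam0.
Qed.

Lemma cons_fam_lift_lift q z (zs : 'I_q.+1 -> Gam) (i : 'I_q.+1) :
  (fun k => cons_fam z zs (lift (lift ord0 i) k)) =
  cons_fam z (fun k => zs (lift i k)).
Proof.
apply/funext => k; case: (unliftP ord0 k) => [j|] ->.
  rewrite cons_fam_lift.
  have -> : lift (lift ord0 i) (lift ord0 j) = lift ord0 (lift i j).
    by apply: val_inj; rewrite /= /bump !leq0n !add1n ltnS ?addnS.
  by rewrite cons_fam_lift.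
have -> : lift (lift ord0 i) ord0 = ord0 by exact: val_inj.
by rewrite !cons_fam0.
Qed.

Lemma cons_fam_lift_perm q z (zs : 'I_q -> Gam) (s : 'S_q) :
  (fun k => cons_fam z zs (lift_perm ord0 ord0 s k)) = cons_fam z (fun k => zs (s k)).
Proof.
apply/funext => k; case: (unliftP ord0 k) => [j|] ->.
  by rewrite lift_perm_lift !cons_fam_lift.
by rewrite lift_perm_id !cons_fam0.
Qed.

Lemma cons_fam_tperm q u v (zs : 'I_q -> Gam) :
  (fun k => cons_fam u (cons_fam v zs) (tperm ord0 (lift ord0 ord0) k)) =
  cons_fam v (cons_fam u zs).
Proof.
apply/funext => k; case: (unliftP ord0 k) => [j|] ->; last first.
  by rewrite tpermL cons_fam_lift !cons_fam0.
case: (unliftP ord0 j) => [i|] ->; last first.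
  by rewrite tpermR cons_fam_lift !cons_fam0.
by rewrite tpermD ?neq_lift ?(inj_eq lift_inj) // !cons_fam_lift.
Qed.

Lemma form_swap01 q (w : altform A q.+2) u v (zs : 'I_q -> Gam) :
  w (cons_fam v (cons_fam u zs)) = - w (cons_fam u (cons_fam v zs)).
Proof.
have [_ al] := formP w.
by rewrite -cons_fam_tperm al odd_tperm neq_lift expr1 mulN1r.
Qed.

(** The cycle [lift_perm ord0 j 1], of sign (-1)^j, relates the two families. The bracket stands
    first in [d_fun] but in place [j] in [Lie_fun]. *)
Lemma form_upd_cycle q (w : altform A q.+1) u (zs : 'I_q.+1 -> Gam) (j : 'I_q.+1) :
  w (cons_fam u (fun k => zs (lift j k))) = (-1) ^+ j * w (upd zs j u).
Proof.
have [_ al] := formP w.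
have -> : cons_fam u (fun k => zs (lift j k)) =
    fun k => upd zs j u (lift_perm ord0 j 1 k).
  apply/funext => k; case: (unliftP ord0 k) => [i|] ->.
    by rewrite lift_perm_lift perm1 cons_fam_lift /upd eq_sym (negbTE (neq_lift _ _)).
  by rewrite lift_perm_id cons_fam0 /upd eqxx.
by rewrite al odd_lift_perm odd_perm1 addbF /= signr_odd.
Qed.

Lemma form_consN q (w : altform A q.+1) u (zs : 'I_q -> Gam) :
  w (cons_fam (- u) zs) = - w (cons_fam u zs).
Proof.
have [ml _] := formP w.
have h a x y := ml (cons_fam u zs) ord0 a x y.
have h0 : w (cons_fam 0 zs) = 0.
  (* Linearity at -1 *: 0 + 0 expresses the value at 0 as its own negative plus itself. *)
  have := h (-1) 0 0; rewrite !upd_cons_fam0 scaler0 addr0 mulN1r addNr; exact.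
by have := h (-1) u 0; rewrite !upd_cons_fam0 addr0 scaleN1r h0 addr0 mulN1r.
Qed.

Lemma gla_br_anti u v : gla_br u v = - gla_br v u.
Proof.
have [brDl brDr br0 _] := gla_lie A.
apply/eqP; rewrite -addr_eq0; apply/eqP.
have Dl x y t : gla_br (x + y) t = gla_br x t + gla_br y t :> Gam.
  by have := brDl 1 x y t; rewrite sconst1 !scale1r.
have Dr x y t : gla_br t (x + y) = gla_br t x + gla_br t y :> Gam.
  by have := brDr 1 x y t; rewrite sconst1 !scale1r.
by have := br0 (u + v); rewrite Dl !Dr !br0 add0r addr0.
Qed.
End ConsFam.

(** * The differential as a recursion on the degree *)

Section Differential.
Variables (R : realType) (M N : manifold R) (A : gen_lie_algebroid M N).
Local Notation Gam := (section (gla_F A)).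
Implicit Types (u v z : Gam).

(** Splitting the bracket off [bracket_args] makes it exchangeable with the next argument. For
    [i <> j] the list has exactly [q] entries, so the default 0 is never read. *)
Definition omit2 q (z : 'I_q.+2 -> Gam) (i j : 'I_q.+2) : 'I_q -> Gam :=
  fun k => nth 0 [seq z l | l <- enum 'I_q.+2 & l \notin [:: i; j]] k.

Lemma bracket_argsE q (z : 'I_q.+2 -> Gam) i j :
  bracket_args z i j = cons_fam (gla_br (z i) (z j)) (omit2 z i j).
Proof.
by apply/funext => k; case: (unliftP ord0 k) => [l|] ->; rewrite ?cons_fam_lift ?cons_fam0.
Qed.

Lemma omit2_cons0 q z (zs : 'I_q.+1 -> Gam) j :
  omit2 (cons_fam z zs) ord0 (lift ord0 j) = fun k => zs (lift j k).
Proof.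
apply/funext => k; rewrite /omit2 enum_ordSl /= filter_map -map_comp.
rewrite (eq_filter (a2 := fun l => l != j)); last first.
  move=> l /=; rewrite !inE negb_or (inj_eq lift_inj).
  by rewrite eq_sym neq_lift.
rewrite filter_neq_enum_ord -map_comp (nth_map k) ?size_enum_ord //.
by rewrite nth_ord_enum /= cons_fam_lift.
Qed.

Lemma omit2_cons_lift q z (zs : 'I_q.+2 -> Gam) i j :
  omit2 (cons_fam z zs) (lift ord0 i) (lift ord0 j) = cons_fam z (omit2 zs i j).
Proof.
apply/funext => k; rewrite /omit2 enum_ordSl /=.
rewrite filter_map -map_comp cons_fam0.
rewrite (eq_filter (a2 := fun l => l \notin [:: i; j])); last first.
  by move=> l /=; rewrite !inE !(inj_eq lift_inj).
rewrite (eq_map (g := zs)); last by move=> l /=; rewrite cons_fam_lift.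
by case: (unliftP ord0 k) => [l|] ->; rewrite ?cons_fam_lift ?cons_fam0.
Qed.

Lemma d_fun0 (w : altform A 0) zs :
  d_fun w zs = vf_act (gla_anchor (zs ord0)) (w (fun k => zs (lift ord0 k))).
Proof. by rewrite /d_fun !big_ord1 expr0 mul1r big_mkcond /= big_ord1 /= addr0. Qed.

(** The terms where [z] differentiates or enters the bracket form the Lie derivative. In all others
    [z] is an argument of [w], and they form the differential of [iprod z w] with the opposite
    sign. *)
Lemma d_fun_cons q (w : altform A q.+1) z (zs : 'I_q.+1 -> Gam) :
  d_fun w (cons_fam z zs) = Lie_fun z w zs - d_fun (iprod z w) zs.
Proof.
rewrite /d_fun /Lie_fun [in LHS]big_ord_recl expr0 mul1r cons_fam0 cons_fam_comp_lift.
under eq_bigr => i _ do rewrite cons_fam_lift cons_fam_lift_lift lift0 exprS -mulrA mulN1r.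
rewrite sumrN [X in _ + X]big_ord_recl.
(* Pairs (0, j+1): moving the bracket to place [j] costs (-1)^j, which reduces the sign (-1)^(j+1)
   to -1. *)
rewrite [X in _ + (X + _)](_ : _ =
  - \sum_(j < q.+1) w (upd zs j (gla_br z (zs j)))); last first.
  rewrite sum_ord_gt0 -sumrN; apply: eq_bigr => j _.
  rewrite bracket_argsE cons_fam0 cons_fam_lift omit2_cons0 form_upd_cycle.
  by rewrite lift0 add0n exprS -mulrA mulN1r mulrA -expr2 sqrr_sign mul1r.
(* Pairs (i+1, j+1): the two index shifts cancel in the sign; the minus comes from exchanging the
   bracket with [z]. *)
rewrite [X in _ + (_ + X)](_ : _ =
  - \sum_(i < q.+1) \sum_(j < q.+1 | (i < j)%N)
      (-1) ^+ (i + j) * iprod z w (bracket_args zs i j)); last first.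
  rewrite -sumrN; apply: eq_bigr => i _.
  rewrite sum_ord_gt_lift -sumrN; apply: eq_bigr => j ij.
  rewrite !lift0 addSn addnS !exprS !mulrA mulrNN !mul1r -mulrN; congr (_ * _).
  (* [omit2] needs two arguments; with a single one there is no pair [i < j]. *)
  case: q w zs i j ij => [|q] w zs i j ij; first by rewrite !ord1 in ij.
  rewrite !bracket_argsE !cons_fam_lift omit2_cons_lift.
  exact: form_swap01.
rewrite opprD -!addrA; congr (_ + _).
by rewrite addrCA.
Qed.

(** The term of index 0 in the bracket sum carries [u, v]; the others belong to the Lie derivative
    of [iprod v w]. This is the commutator of L_u and i_v, evaluated. *)
Lemma Lie_fun_cons q (w : altform A q.+1) u v (zs : 'I_q -> Gam) :
  Lie_fun u w (cons_fam v zs) =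
  Lie_fun u (iprod v w) zs - w (cons_fam (gla_br u v) zs).
Proof.
rewrite /Lie_fun big_ord_recl cons_fam0 upd_cons_fam0 /=.
under eq_bigr => i _ do rewrite cons_fam_lift upd_cons_fam_lift.
by rewrite opprD addrCA addrC -addrA addrC -!addrA [X in _ + X]addrC.
Qed.

Lemma d_fun_swap01 q (w : altform A q.+1) u v (zs : 'I_q -> Gam) :
  d_fun w (cons_fam v (cons_fam u zs)) = - d_fun w (cons_fam u (cons_fam v zs)).
Proof.
have br_swap : w (cons_fam (gla_br v u) zs) = - w (cons_fam (gla_br u v) zs).
  by rewrite gla_br_anti form_consN.
apply/eqP; rewrite -addr_eq0 !d_fun_cons !Lie_fun_cons br_swap.
(* Here [a] and [b] stand for L_v (i_u w) and L_u (i_v w), [c] for w([u, v], zs) and [e] for d (i_u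
   (i_v w)), all evaluated at [zs]. *)
have cancel (a b c e : smooth_fun N) : a + c - (b - e) + (b - c - (a + e)) = 0.
  by apply/eqP; rewrite addr_eq0 !opprB addrACA.
case: q w zs br_swap => [|q] w zs _; last first.
  rewrite !d_fun_cons.
  have -> : d_fun (iprod v (iprod u w)) zs = - d_fun (iprod u (iprod v w)) zs.
    rewrite /d_fun opprD -!sumrN; congr (_ + _); apply: eq_bigr => i _.
      by rewrite /= form_swap01 vf_actN mulrN.
    by rewrite -sumrN; apply: eq_bigr => j _; rewrite /= form_swap01 mulrN.
  by rewrite !opprK cancel.
(* For [w] of degree 1 the second interior product vanishes, so [e] is 0. *)
rewrite !d_fun0 !cons_fam0 !cons_fam_comp_lift /Lie_fun !big_ord0 !subr0 opprK.
apply/eqP; have := cancel (vf_act (gla_anchor v) (w (cons_fam u zs)))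
  (vf_act (gla_anchor u) (w (cons_fam v zs))) (w (cons_fam (gla_br u v) zs)) 0.
by rewrite subr0 addr0.
Qed.
End Differential.

(** * The differential of a form is a form; Cartan's formula and uniqueness *)

Section DifferentialForm.
Variables (R : realType) (M N : manifold R) (A : gen_lie_algebroid M N).
Local Notation Gam := (section (gla_F A)).

(* [alternating] alone would be [trigo.alternating]. *)
Lemma alternating_cons q (F : ('I_q.+2 -> Gam) -> smooth_fun N) :
  (forall u zs (s : 'S_q.+1),
    F (cons_fam u (fun i => zs (s i))) = (-1) ^+ s * F (cons_fam u zs)) ->
  (forall u v zs, F (cons_fam v (cons_fam u zs)) = - F (cons_fam u (cons_fam v zs))) ->
  Defs.alternating F.
Proof.
move=> Ftail Fswap.
(* Good permutations are closed under products. Those fixing 0 and the transposition (0 1) are good,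
   and they generate the whole group. *)
pose good (s : 'S_q.+2) := forall z, F (fun i => z (s i)) = (-1) ^+ s * F z.
have goodM s t : good s -> good t -> good (s * t)%g.
  move=> gs gt z; rewrite odd_permM signr_addb -mulrA -gt -gs; congr (F _).
  by apply/funext => i; rewrite permM.
have goodl s : good (lift_perm ord0 ord0 s).
  move=> z; have [u [zs ->]] := cons_famP z.
  by rewrite cons_fam_lift_perm Ftail odd_lift_perm.
have good01 : good (tperm ord0 (lift ord0 ord0)).
  move=> z; rewrite odd_tperm neq_lift expr1 mulN1r.
  have [u [zs ->]] := cons_famP z; have [v [us ->]] := cons_famP zs.
  by rewrite cons_fam_tperm Fswap.
(* (0 j+1) is the conjugate of (0 1) by a permutation fixing 0. *)
have good0 j : good (tperm ord0 (lift ord0 j)).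
  rewrite -[j](tpermL ord0) -(lift_perm_lift ord0) -{1}(lift_perm_id ord0 ord0 (tperm ord0 j)).
  rewrite -tpermJ /conjg lift_permV.
  exact: (goodM _ _ (goodl _) (goodM _ _ good01 (goodl _))).
have goodt i j : good (tperm i j).
  case: (unliftP ord0 i) => [i'|] ->; case: (unliftP ord0 j) => [j'|] -> //.
  - have -> : tperm (lift ord0 i') (lift ord0 j') = lift_perm ord0 ord0 (tperm i' j') => //.
    apply/permP => k; case: (unliftP ord0 k) => [k'|] ->.
      by rewrite lift_perm_lift (inj_tperm _ _ _ lift_inj).
    by rewrite lift_perm_id tpermD // eq_sym neq_lift.
  - by rewrite tpermC.
  - by rewrite tperm1 -(lift_perm1 ord0); exact: goodl.
move=> z s; suff : good s by exact.
have [ts -> _] := prod_tpermP s; elim: ts => [|t ts IH].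
  by rewrite big_nil -(lift_perm1 ord0); exact: goodl.
by rewrite big_cons; exact: goodM (goodt _ _) IH.
Qed.

Lemma d_fun_form q (w : altform A q) : multilinear (d_fun w) /\ Defs.alternating (d_fun w).
Proof.
elim: q w => [|q IH] w.
  split=> [z i f u v|z s]; last first.
    have -> : s = 1%g by exact: permS1.
    rewrite odd_perm1 mul1r; congr (d_fun w _).
    by apply/funext => i; rewrite perm1.
  (* Any representative of the empty family serves; a constant one frees the differentiated function
     from [zs]. *)
  have E zs : d_fun w zs = vf_act (gla_anchor (zs ord0)) (w (fun=> 0)).
    by rewrite d_fun0; congr (vf_act _ (fval _ _)); apply/funext; case.
  rewrite !E (ord1 i) /upd !eqxx.
  have [aD aZ _] := gla_morphism A.
  by rewrite /gla_anchor aD aZ vf_act_linl.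
have al : Defs.alternating (d_fun w).
  apply: alternating_cons => [u zs s|u v zs]; last exact: d_fun_swap01.
  rewrite !d_fun_cons.
  have [_ ->] := Lie_fun_form u w; have [_ ->] := IH (iprod u w).
  exact/esym/mulrBr.
split=> //.
(* Away from the first argument both terms of the recursion are already multilinear; the first
   argument is then exchanged with the second. *)
have mlS z i f u v : d_fun w (upd z (lift ord0 i) (f *: u + v)) =
    f * d_fun w (upd z (lift ord0 i) u) + d_fun w (upd z (lift ord0 i) v).
  have [z0 [zs ->]] := cons_famP z; rewrite !upd_cons_fam_lift !d_fun_cons.
  have [-> _] := Lie_fun_form z0 w; have [-> _] := IH (iprod z0 w).
  by rewrite [X in _ = X + _]mulrBr opprD addrACA.
move=> z i; case: (unliftP ord0 i) => [j|] -> f u v; first exact: mlS.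
have [a [z' ->]] := cons_famP z; have [b [zs ->]] := cons_famP z'.
have swap t : d_fun w (upd (cons_fam a (cons_fam b zs)) ord0 t) =
    - d_fun w (upd (cons_fam b (cons_fam a zs)) (lift ord0 ord0) t).
  by rewrite upd_cons_fam0 upd_cons_fam_lift upd_cons_fam0 d_fun_swap01.
by rewrite !swap mlS opprD mulrN.
Qed.

Definition d_form q (w : altform A q) : altform A q.+1 := mkform (d_fun_form w).

Lemma altform_ext q (w w' : altform A q) : (forall z, w z = w' z) -> w = w'.
Proof. by move=> ww'; apply/val_inj/funext. Qed.

(** Scalars are constants because the anchored fields differentiate a function coefficient. *)
Lemma d_fun_linear q (a : R) (w w' : altform A q) z :
  d_fun (sconst N a *: w + w') z = sconst N a * d_fun w z + d_fun w' z.
Proof.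
have E y : (sconst N a *: w + w') y = sconst N a * w y + w' y by [].
rewrite /d_fun mulrDr addrACA; congr (_ + _);
  rewrite mulr_sumr -big_split; apply: eq_bigr => i _.
  by rewrite E vf_actD vf_actZ mulrDr mulrCA.
rewrite mulr_sumr -big_split; apply: eq_bigr => j _.
by rewrite E mulrDr mulrCA.
Qed.

Lemma cartan_d_form : cartan d_form.
Proof.
move=> z [|q] w; apply: altform_ext => zs; last first.
  rewrite -[RHS]/(d_fun (iprod z w) zs + d_fun w (cons_fam z zs)) d_fun_cons.
  by rewrite addrC subrK.
rewrite -[RHS]/(0 + d_fun w (cons_fam z zs)) add0r d_fun0.
rewrite cons_fam0 cons_fam_comp_lift -[LHS]/(Lie_fun z w zs).
by rewrite /Lie_fun big_ord0 subr0.
Qed.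

(** A form of positive degree is determined by its interior products. Once the operators agree on
    [iprod z w], cancelling in Cartan's formula equates the interior products of [d w] and
    [d' w]. *)
Lemma cartan_unique (d d' : forall q, altform A q -> altform A q.+1) :
  cartan d -> cartan d' -> forall q (w : altform A q), d' q w = d q w.
Proof.
move=> Cd Cd'; elim=> [|q IH] w; apply: altform_ext => z;
  have [z0 [zs ->]] := cons_famP z;
  rewrite -[LHS]/(iprod z0 (d' _ w) zs) -[RHS]/(iprod z0 (d _ w) zs);
  congr (fval _ zs).
  by have := Cd z0 0 w; rewrite Cd' => /addrI.
by have := Cd z0 q.+1 w; rewrite Cd' /= IH => /addrI.
Qed.
End DifferentialForm.

Theorem theorem2p7 (R : realType) (M N : manifold R) (A : gen_lie_algebroid M N) :
  exists d : forall q : nat, altform A q -> altform A q.+1,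
    [/\ forall (q : nat) (w : altform A q) (z : 'I_q.+1 -> section (gla_F A)),
          d q w z = d_fun w z,
        forall (q : nat) (a : R) (w w' : altform A q),
          d q (sconst N a *: w + w') = sconst N a *: d q w + d q w',
        cartan d
      & forall d' : (forall q : nat, altform A q -> altform A q.+1),
          cartan d' -> forall (q : nat) (w : altform A q), d' q w = d q w].
Proof.
exists (@d_form R M N A); split=> //.
- by move=> q a w w'; apply: altform_ext => z; exact: d_fun_linear.
- exact: cartan_d_form.
- by move=> d' Cd' q w; apply: cartan_unique Cd' q w; exact: cartan_d_form.
Qed.
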